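(* Let $\mathbb{X}$ and $\mathbb{Y}$ be finite-dimensional (real) polyhedral Banach spaces, where $\dim(\mathbb{X})=n$. Let $T \in \mathbb{L}(\mathbb{X},\mathbb{Y})$ with $\|T\|=1$ and $\operatorname{rank} T = 1$. Then $T$ is an extreme contraction if and only if there exists a facet $F$ of the polyhedron $B_{\mathbb{X}}$ such that $M_T = F \cup (-F)$ and $Tx \in Ext(B_{\mathbb{Y}})$ for every $x \in F$.
   Context: All Banach spaces are real. $B_{\mathbb{X}}$ and $S_{\mathbb{X}}$ denote the closed unit ball and unit sphere of $\mathbb{X}$. $Ext(A)$ is the set of extreme points of a convex set $A$. $\mathbb{L}(\mathbb{X},\mathbb{Y})$ is the space of bounded linear operators from $\mathbb{X}$ to $\mathbb{Y}$ with the operator norm. An extreme contraction is an extreme point of the unit ball $B_{\mathbb{L}(\mathbb{X},\mathbb{Y})}$. $M_T=\{x\in S_{\mathbb{X}}: \|Tx\|=\|T\|\}$ is the norm attainment set of $T$. A finite-dimensional Banach space $\mathbb{X}$ is polyhedral if $Ext(B_{\mathbb{X}})$ is finite; in other words, $B_{\mathbb{X}}$ is a polyhedron in $\mathbb{R}^n$ for some natural number $n\geq 2$. A polyhedron $P$ is a non-empty compact set which is a finite intersection of closed half-spaces; its dimension is the dimension of the subspace generated by the differences $v-w$, $v,w\in P$. A polyhedron $Q$ is a face of $P$ if either $Q=P$ or $Q=P\cap\delta M$, where $M$ is a closed half-space containing $P$ and $\delta M$ is its boundary. If $\dim(\mathbb{X})=n$, a facet of $B_{\mathbb{X}}$ is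 a face of dimension $n-1$. *)

(* Defs.v *)
From HB Require Import structures.
From mathcomp Require Import all_boot all_order all_algebra.
From mathcomp Require Import all_classical all_reals all_analysis.

Set Implicit Arguments.
Unset Strict Implicit.
Unset Printing Implicit Defensive.

Import Order.TTheory GRing.Theory Num.Theory.
Import numFieldNormedType.Exports.

Local Open Scope classical_set_scope.
Local Open Scope ring_scope.

(* A finite-dimensional Banach space over R is a complete normed module that
   is also a vectType; the two structures share one R-module structure, and
   the norm is otherwise unconstrained. *)
#[short(type="banachVectType")]
HB.structure Definition BanachVector (R : numFieldType) :=
  {V of CompleteNormedModule R V & Vector R V}.

Definition extreme_points (R : numDomainType) (V : lmodType R) (A : set V) :
    set V :=
  [set x | A x /\
    forall (y z : V) (t : R), A y -> A z -> 0 < t < 1 ->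
      x = t *: y + (1 - t) *: z -> y = x /\ z = x].

Section FiniteDimensionalBanach.
Context {R : realType}.

Section Space.
Context {V : banachVectType R}.

Definition unit_ball : set V := [set x | `|x| <= 1].

Definition unit_sphere : set V := [set x | `|x| = 1].

Definition closed_halfspace (M : set V) : Prop :=
  exists (f : 'Hom(V, R^o)) (c : R), f != 0 /\ M = [set x | f x <= c].

Definition boundary (A : set V) : set V := closure A `\` interior A.

Definition polyhedron (P : set V) : Prop :=
  [/\ P !=set0, compact P &
    exists (m : nat) (M : 'I_m -> set V),
      (forall i, closed_halfspace (M i)) /\ P = \bigcap_i M i].

Definition is_span (A : set V) (U : {vspace V}) : Prop :=
  (forall x, A x -> x \in U) /\
  (forall W : {vspace V}, (forall x, A x -> x \in W) -> (U <= W)%VS).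

Definition polyhedron_dim (P : set V) (d : nat) : Prop :=
  exists2 U : {vspace V},
    is_span [set v - w | v in P & w in P] U & \dim U = d.

Definition face (P Q : set V) : Prop :=
  polyhedron Q /\
  (Q = P \/
   exists M, [/\ closed_halfspace M, P `<=` M & Q = P `&` boundary M]).

(* The dimension condition dim F = n - 1 is written d + 1 = n, which avoids
   truncated subtraction. *)
Definition unit_ball_facet (F : set V) : Prop :=
  face unit_ball F /\
  exists2 d, polyhedron_dim F d & d.+1 = \dim {:V}.

End Space.

Definition polyhedral (V : banachVectType R) : Prop :=
  finite_set (extreme_points (@unit_ball V)).

Section Operators.
Context {X Y : banachVectType R}.

(* Every linear map between finite-dimensional normed spaces is bounded, so
   'Hom(X, Y) is the whole space of bounded operators and the supremum below
   is that of a nonempty bounded set. *)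
Definition opnorm (T : 'Hom(X, Y)) : R := sup [set `|T x| | x in unit_ball].

Definition opnorm_ball : set 'Hom(X, Y) := [set T | opnorm T <= 1].

Definition extreme_contraction (T : 'Hom(X, Y)) : Prop :=
  extreme_points opnorm_ball T.

Definition norm_attainment (T : 'Hom(X, Y)) : set X :=
  [set x | unit_sphere x /\ `|T x| = opnorm T].

End Operators.
End FiniteDimensionalBanach.

(* Main.v *)
Require Import Defs.
From HB Require Import structures.
From mathcomp Require Import all_boot all_order all_algebra.
From mathcomp Require Import all_classical all_reals all_analysis.
From mathcomp Require Import ring lra zify.
Import Order.TTheory GRing.Theory Num.Theory.
Import numFieldNormedType.Exports.
Local Open Scope classical_set_scope.
Local Open Scope ring_scope.

(** Write a rank-one map of norm 1 as [T x = f x *: y] with [`|y| = 1]; then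
    [f] is bounded by 1 on the unit ball [B] of [X], and [T] attains its norm
    on [F] and [- F], where [F = B `&` [set x | f x = 1]] is the slice
    [unit_slice f].  The whole equivalence is about how large [F] is.

    If [T] takes extreme values on a set that spans [X], then any
    decomposition [T = t *: A + (1 - t) *: B] forces [A] and [B] to agree with
    [T] on that set, hence everywhere ([spanning_extreme_contraction]).  A
    facet does span [X]: the differences of its points have dimension
    [dim X - 1], and the facet lies in a hyperplane that misses the origin,
    because [0] is interior to [B] ([facet_spanning]).

    Conversely, let [T] be extreme.  Moving [y] inside the ball of [Y] moves
    [T] inside the operator ball, so [y] is extreme ([dyad_extreme_vector]).
    Moving [f] also moves [T]; if a functional [g] vanishes on [F], then
    [f + e *: g] and [f - e *: g] remain bounded by 1 at the finitely many
    extreme points of [B] for small [e], so [g = 0]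
    ([dyad_extreme_separating]).  Thus [F] spans [X], and it is a facet
    ([unit_slice_facet]).

    Two classical facts support this.  The first is that [B] is contained in
    every convex set that contains its extreme points
    ([unit_ball_sub_convex]).  Together with the finiteness of the set of
    extreme points it gives the boundedness and the continuity of all linear
    maps on [X] and the bounds for [f + e *: g].  It also shows that [F] is
    the slice [f = 1] of a finitely generated cone ([unit_slice_cone]).  The
    second is that a finitely generated cone is a finite intersection of
    half-spaces ([cone_halfspaces]), which makes [F] a polyhedron
    ([cone_slice_polyhedron]). *)

(** * Spans and rank-one maps *)

Section LinearAlgebra.
Set Implicit Arguments.
Unset Strict Implicit.
Context {R : realType}.

(** A sequence of elements of [A] whose span misses some element of [A] can be
    extended by that element, and the dimension bounds the number of such
    extensions. *)
Lemma exists_spanning_seq {V : vectType R} (A : set V) :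
  exists2 vs : seq V, (forall x, x \in vs -> A x) &
    forall x, A x -> x \in <<vs>>%VS.
Proof.
suff H k : forall vs : seq V, (\dim {:V} - \dim <<vs>>%VS < k)%N ->
    (forall x, x \in vs -> A x) ->
    exists2 vs : seq V, (forall x, x \in vs -> A x) &
      forall x, A x -> x \in <<vs>>%VS.
  by apply: (H _ [::]) => //; apply: ltnSn.
elim: k => // k IHk vs les sA.
have [sP|] := pselect (forall x, A x -> x \in <<vs>>%VS); first by exists vs.
move=> /existsNP[x /not_implyP[Ax /negP xs]].
apply: (IHk (x :: vs)); last first.
  by move=> y; rewrite inE => /orP[/eqP ->//|/sA].
have lt_s : (\dim <<vs>>%VS < \dim <<x :: vs>>%VS)%N.
  rewrite ltn_neqAle; have sub : (<<vs>> <= <<x :: vs>>)%VS.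
    by apply: sub_span => y ys; rewrite inE ys orbT.
  rewrite dimvS // andbT; apply: contra xs => /eqP eq_dim.
  have /eqP -> : <<vs>>%VS == <<x :: vs>>%VS by rewrite eqEdim sub eq_dim leqnn.
  by rewrite memv_span // inE eqxx.
have := dimvS (subvf <<x :: vs>>%VS).
lia.
Qed.

Lemma exists_is_span {V : banachVectType R} (A : set V) :
  exists U : {vspace V}, is_span A U.
Proof.
have [vs sA As] := exists_spanning_seq A.
by exists <<vs>>%VS; split=> // W AW; apply/span_subvP => x /sA/AW.
Qed.

(** The tensor of the functional [f] and the vector [y]. *)
Definition dyad {V W : vectType R} (f : 'Hom(V, R^o)) (y : W) (x : V) : W :=
  f x *: y.

Lemma dyad_is_linear {V W : vectType R} (f : 'Hom(V, R^o)) (y : W) :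
  linear (dyad f y).
Proof. by move=> a u v; rewrite /dyad linearP /= scalerDl scalerA. Qed.

HB.instance Definition _ {V W : vectType R} (f : 'Hom(V, R^o)) (y : W) :=
  GRing.isLinear.Build R V W *:%R (dyad f y) (dyad_is_linear f y).

Lemma dyadE {V W : vectType R} (f : 'Hom(V, R^o)) (y : W) x :
  linfun (dyad f y) x = f x *: y.
Proof. exact: lfunE. Qed.

(** The range of a map of rank one is a line; [f] is the coordinate of [T x]
    along a generator of that line. *)
Lemma rank_one_dyad {V W : vectType R} (T : 'Hom(V, W)) :
  \dim (limg T) = 1%N ->
  exists2 y : W, y != 0 & exists f : 'Hom(V, R^o), T = linfun (dyad f y).
Proof.
move=> rankT.
have y0 : vpick (limg T) != 0 by rewrite vpick0 -dimv_eq0 rankT.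
set y := vpick (limg T) in y0 *.
exists y => //.
have limgE : limg T = <[y]>%VS.
  apply/eqP; rewrite eq_sym eqEdim dim_vline y0 rankT leqnn andbT.
  by rewrite -memvE memv_pick.
exists (linfun (coord [tuple y] ord0) \o T)%VF.
apply/lfunP => x; rewrite dyadE comp_lfunE lfunE /=.
have yfree : free [tuple y] by rewrite seq1_free.
have /vlineP[k ->] : T x \in <[y]>%VS by rewrite -limgE memv_img ?memvf.
congr (_ *: _).
rewrite linearZ /=.
have /= c1 : coord [tuple y] ord0 y = 1 := coord_free ord0 ord0 yfree.
by rewrite [X in _ = _ *: X]c1 [RHS]mulr1.
Qed.

Lemma exists_functional_basis (V : vectType R) :
  exists fs : seq 'Hom(V, R^o),
    forall x, (forall f, f \in fs -> f x = 0) -> x = 0.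
Proof.
exists [seq linfun (coord (vbasis {:V}) i) : 'Hom(V, R^o) | i <- enum 'I_(\dim {:V})].
move=> x fx; rewrite (coord_vbasis (memvf x)) big1 // => i _.
have := fx (linfun (coord (vbasis {:V}) i)); rewrite lfunE /= => -> //.
  by rewrite scale0r.
by apply: map_f; rewrite mem_enum.
Qed.

End LinearAlgebra.

(** * Extreme points generate a unit ball *)

Section ExtremePoints.
Set Implicit Arguments.
Unset Strict Implicit.
Context {R : realType} {V : banachVectType R}.
Implicit Types (x y u : V) (C : set V).

Definition convex_subset C := forall x y (t : R), C x -> C y -> 0 < t < 1 ->
  C (t *: x + (1 - t) *: y).

(** The directions in which [x] can move both ways inside the unit ball.  For
    [x] in the ball they form a linear subspace, which is zero exactly when
    [x] is extreme; its dimension is that of the smallest face containing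
    [x]. *)
Definition ball_direction x : set V :=
  [set u | exists2 e : R, 0 < e & `|x + e *: u| <= 1 /\ `|x - e *: u| <= 1].

Lemma norm_convex {W : normedModType R} (x y : W) (c t : R) :
  0 <= t <= 1 -> `|x| <= c -> `|y| <= c -> `|t *: x + (1 - t) *: y| <= c.
Proof.
move=> /andP[t0 t1] xc yc; apply: (le_trans (ler_normD _ _)).
rewrite !normrZ (ger0_norm t0) ger0_norm ?subr_ge0 //.
have s0 : 0 <= 1 - t by rewrite subr_ge0.
have := ler_wpM2l t0 xc; have := ler_wpM2l s0 yc; lra.
Qed.

Lemma convex_comb_line x u (t a b : R) :
  t *: (x + a *: u) + (1 - t) *: (x + b *: u) = x + (t * a + (1 - t) * b) *: u.
Proof.
rewrite !scalerDr addrACA -!scalerDl !scalerA -scalerDl.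
by rewrite [t + _]addrC subrK scale1r.
Qed.

Lemma ball_directionN x u : ball_direction x u -> ball_direction x (- u).
Proof. by move=> [e e0 [H1 H2]]; exists e => //; rewrite scalerN opprK. Qed.

Lemma ball_direction_small x u (e d : R) :
  `|x + e *: u| <= 1 -> `|x - e *: u| <= 1 -> 0 < d <= e ->
  `|x + d *: u| <= 1.
Proof.
move=> H1 H2 /andP[d0 de].
have e0 : 0 < e by lra.
pose t := (e + d) / (2 * e).
have tE : t * (2 * e) = e + d by rewrite /t divfK // mulf_neq0 // gt_eqF.
have -> : x + d *: u = t *: (x + e *: u) + (1 - t) *: (x - e *: u).
  rewrite -(scaleNr e u) convex_comb_line; congr (_ + _ *: _); lra.
apply: norm_convex => //; apply/andP; split; nra.
Qed.

Lemma ball_directionD x u v : ball_direction x u -> ball_direction x v ->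
  ball_direction x (u + v).
Proof.
move=> xu xv.
have [d d0 [ud vd]] : exists2 d : R, 0 < d &
    (`|x + d *: u| <= 1 /\ `|x - d *: u| <= 1) /\
    (`|x + d *: v| <= 1 /\ `|x - d *: v| <= 1).
  move: xu xv => [e e0 [H1 H2]] [e' e'0 [H1' H2']].
  exists (Num.min e e'); first by rewrite lt_min e0 e'0.
  have m0 : 0 < Num.min e e' by rewrite lt_min e0 e'0.
  split; split.
  - by apply: (ball_direction_small H1 H2); rewrite m0 ge_min lexx.
  - rewrite -scalerN; apply: (@ball_direction_small x (- u) e); rewrite ?scalerN ?opprK //.
    by rewrite m0 ge_min lexx.
  - by apply: (ball_direction_small H1' H2'); rewrite m0 ge_min lexx orbT.
  - rewrite -scalerN; apply: (@ball_direction_small x (- v) e'); rewrite ?scalerN ?opprK //.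
    by rewrite m0 ge_min lexx orbT.
exists (d / 2); first by lra.
have mid (a b : V) : `|x + d *: a| <= 1 -> `|x + d *: b| <= 1 ->
    `|x + (d / 2) *: (a + b)| <= 1.
  move=> Ha Hb.
  have -> : x + (d / 2) *: (a + b) =
      2^-1 *: (x + d *: a) + (1 - 2^-1) *: (x + d *: b).
    have -> : 1 - 2^-1 = 2^-1 :> R by field.
    rewrite -scalerDr addrACA [RHS]scalerDr -[x + x]mulr2n -(scaler_nat 2 x) scalerA.
    by rewrite mulVf ?pnatr_eq0 // scale1r -scalerDr scalerA [2^-1 * d]mulrC.
  by apply: norm_convex => //; lra.
split; first by apply: mid; tauto.
rewrite -scalerN opprD; apply: mid; rewrite scalerN; tauto.
Qed.

Lemma ball_directionZ x u (a : R) : `|x| <= 1 -> ball_direction x u ->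
  ball_direction x (a *: u).
Proof.
move=> x1 [e e0 [H1 H2]].
have [-> | a0] := eqVneq a 0.
  by exists 1 => //; rewrite !scale0r scaler0 subr0 addr0.
have a0' : `|a| != 0 by rewrite normr_eq0.
exists (e / `|a|); first by rewrite divr_gt0 // normr_gt0.
rewrite scalerA; have [a_ge|a_lt] := leP 0 a.
  by rewrite ger0_norm // divfK.
rewrite ltr0_norm // invrN mulrN mulNr divfK // ?scaleNr ?opprK //.
Qed.

Lemma ball_direction_span x (vs : seq V) : `|x| <= 1 ->
  (forall u, u \in vs -> ball_direction x u) ->
  forall u, u \in <<vs>>%VS -> ball_direction x u.
Proof.
move=> x1; elim: vs => [_ u|v vs IHs sP u].
  rewrite span_nil memv0 => /eqP ->.
  by exists 1 => //; rewrite !scaler0 subr0 addr0.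
rewrite span_cons => /memv_addP[_ /vlineP[k ->] [w ws ->]].
apply: ball_directionD.
  by apply: ball_directionZ => //; apply: sP; rewrite inE eqxx.
by apply: IHs => // y ys; apply: sP; rewrite inE ys orbT.
Qed.

(** A direction admissible at [y] is admissible at every [x] of a segment
    starting at [y], the end opposite to [y] excluded: the segment scales the
    motion by the weight [t] of [y].  Hence the directions at an endpoint are
    also directions at the points in between. *)
Lemma ball_direction_mix x y z u (t : R) : 0 < t <= 1 -> `|z| <= 1 ->
  x = t *: y + (1 - t) *: z -> ball_direction y u -> ball_direction x u.
Proof.
move=> /andP[t0 t1] z1 -> [e e0 [H1 H2]].
exists (t * e); first exact: mulr_gt0.
have mix (v : V) : t *: y + (1 - t) *: z + t *: v =
    t *: (y + v) + (1 - t) *: z by rewrite scalerDr addrAC.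
rewrite -scalerA -scalerN !mix; split; apply: norm_convex; rewrite // t1 ltW //.
Qed.

(** Follow [u] from [x] up to the largest [t] for which [x + t *: u] is in the
    ball.  It is finite since [u != 0], and at that point the motion along [u]
    is blocked. *)
Lemma ball_exit x u : `|x| <= 1 -> u != 0 -> ball_direction x u ->
  exists2 t : R, 0 < t & `|x + t *: u| <= 1 /\ ~ ball_direction (x + t *: u) u.
Proof.
move=> x1 u0 [e e0 [H1 H2]].
have nu : 0 < `|u| by rewrite normr_gt0.
pose S : set R := [set t | 0 <= t /\ `|x + t *: u| <= 1].
have Se : S e by split => //; apply: ltW.
have Sub : ubound S (2 / `|u|).
  move=> t [t0 Ht]; rewrite ler_pdivlMr // -(ger0_norm t0) -normrZ.
  have -> : t *: u = (x + t *: u) - x by rewrite addrC addKr.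
  by apply: (le_trans (ler_normB _ _)); lra.
have hS : has_sup S by split; [exists e | exists (2 / `|u|)].
have eS : e <= sup S by apply: sup_upper_bound.
have S1 : `|x + sup S *: u| <= 1.
  apply/ler_addgt0Pr => d d0.
  have [t [t0 Ht] lt_t] := sup_adherent (divr_gt0 d0 nu) hS.
  have tS : t <= sup S by apply: sup_upper_bound.
  have -> : x + sup S *: u = (x + t *: u) + (sup S - t) *: u.
    by rewrite -addrA -scalerDl [t + _]addrC subrK.
  apply: (le_trans (ler_normD _ _)); apply: lerD => //.
  rewrite normrZ ger0_norm ?subr_ge0 // -ler_pdivlMr //.
  by lra.
exists (sup S); first by lra.
split=> // -[d d0 [Hd _]].
have : sup S + d <= sup S.
  apply: sup_upper_bound => //; split; first by lra.
  by rewrite scalerDl addrA.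
by lra.
Qed.

(** This is the finite-dimensional theorem of Minkowski (Krein-Milman).  A
    point that is not extreme lies on a segment along which the ball is left
    at both ends.  At each end the space of admissible directions is strictly
    smaller than at the point, since it is contained in the old one but has
    lost the direction of the segment; induction on its dimension
    concludes. *)
Lemma unit_ball_sub_convex C : convex_subset C ->
  extreme_points (@unit_ball R V) `<=` C -> @unit_ball R V `<=` C.
Proof.
move=> Cconv extC.
suff H k x (U : {vspace V}) : `|x| <= 1 -> (forall u, ball_direction x u -> u \in U) ->
    (\dim U < k)%N -> C x.
  by move=> x x1; apply: (H _ x {:V}%VS x1 _ (ltnSn _)) => u _; apply: memvf.
elim: k x U => // k IHk x U x1 xU dimU.
have [/extC //|next] := pselect (extreme_points (@unit_ball R V) x).
(* Without a nonzero direction, [x] would be extreme: if [x] is between [y]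
   and [z], then [y - z] is an admissible direction. *)
have [u u0 xu] : exists2 u, u != 0 & ball_direction x u.
  apply: contrapT => nodir; apply: next; split=> // y z t y1 z1 t01 xE.
  have [t0 t1] := andP t01.
  have yx : y - z = 0.
    apply/eqP; apply: contrapT => /negP yz; apply: nodir.
    exists (y - z) => //.
    have d1 : 0 < Num.min t (1 - t) by rewrite lt_min t0 subr_gt0.
    exists (Num.min t (1 - t)) => //.
    have dt : Num.min t (1 - t) <= t by rewrite ge_min lexx.
    have ds : Num.min t (1 - t) <= 1 - t by rewrite ge_min lexx orbT.
    move: (Num.min t (1 - t)) d1 dt ds => d d0 dt ds.
    have mix (c : R) : x + c *: (y - z) = (t + c) *: y + (1 - (t + c)) *: z.
      rewrite xE scalerBr addrACA -scalerDl -scaleNr -scalerDl.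
      by rewrite opprD addrA.
    rewrite -scaleNr !mix.
    by split; apply: norm_convex => //; lra.
  have yzE : y = z by apply/eqP; rewrite -subr_eq0 yx.
  have xz : x = z by rewrite xE yzE -scalerDl addrC subrK scale1r.
  by rewrite xz yzE.
(* The hypothesis that [x] is [r] times the exit point plus [1 - r] times
   some [w] of the ball says that [x] is on a segment starting at the exit
   point; here [w] will be the exit point on the other side. *)
have endpoint v : v != 0 -> ball_direction x v -> exists t : R,
    [/\ 0 < t, `|x + t *: v| <= 1 & forall w (r : R), 0 < r <= 1 -> `|w| <= 1 ->
    x = r *: (x + t *: v) + (1 - r) *: w -> C (x + t *: v)].
  move=> v0 xv; have [t t0 [xt1 xtN]] := ball_exit x1 v0 xv.
  exists t; split=> // w r r01 w1 xE.
  have [vs sD Ds] := exists_spanning_seq (ball_direction (x + t *: v)).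
  apply: (IHk _ <<vs>>%VS) => //.
  have sU : (<<vs>> <= U)%VS.
    apply/span_subvP => z /sD Dz; apply: xU.
    exact: (ball_direction_mix r01 w1 xE).
  rewrite ltnS in dimU; apply: leq_trans dimU; rewrite ltn_neqAle dimvS // andbT.
  apply/negP => /eqP eqd; apply: xtN.
  have /eqP sUE : <<vs>>%VS == U by rewrite eqEdim sU eqd leqnn.
  by apply: (@ball_direction_span _ vs) => //; rewrite sUE; apply: xU.
have [t [t0 a1 Ca]] := endpoint u u0 xu.
have [t' [t'0 b1 Cb]] : exists t' : R, [/\ 0 < t', `|x + t' *: - u| <= 1 &
    forall w (r : R), 0 < r <= 1 -> `|w| <= 1 ->
    x = r *: (x + t' *: - u) + (1 - r) *: w -> C (x + t' *: - u)].
  by apply: endpoint; [rewrite oppr_eq0 | apply: ball_directionN].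
have tt : t + t' != 0 by rewrite gt_eqF // addr_gt0.
(* The weights express [x] as a combination of the two exit points, at
   parameters [r] and [- r'] along the line. *)
have mix (r r' : R) : 0 < r -> 0 < r' -> forall v, x = (r' / (r + r')) *: (x + r *: v) +
    (1 - r' / (r + r')) *: (x + r' *: - v).
  move=> r0 r'0 v; have rr : r + r' != 0 by rewrite gt_eqF // addr_gt0.
  rewrite scalerN -(scaleNr r' v) convex_comb_line.
  have -> : r' / (r + r') * r + (1 - r' / (r + r')) * - r' = 0 by field.
  by rewrite scale0r addr0.
have frac (r r' : R) : 0 < r -> 0 < r' -> 0 < r' / (r + r') < 1.
  move=> r0 r'0; rewrite divr_gt0 ?addr_gt0 //=.
  by rewrite ltr_pdivrMr ?addr_gt0 // mul1r ltrDr.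
have fr := frac _ _ t0 t'0; have fr' := frac _ _ t'0 t0.
rewrite (mix _ _ t0 t'0 u); apply: Cconv => //.
  apply: (Ca (x + t' *: - u) (t' / (t + t'))) => //; first by lra.
  exact: mix.
apply: (Cb (x + t *: u) (t / (t' + t))) => //; first by lra.
by have := mix _ _ t'0 t0 (- u); rewrite opprK.
Qed.

End ExtremePoints.

(** * Linear maps on a polyhedral space *)

Section PolyhedralBoundedness.
Set Implicit Arguments.
Unset Strict Implicit.
Context {R : realType}.

Lemma ball_bound_norm {V W : normedModType R} (f : {linear V -> W}) (c : R) :
  (forall x, `|x| <= 1 -> `|f x| <= c) -> forall x, `|f x| <= c * `|x|.
Proof.
move=> fc x; have [->|x0] := eqVneq x 0; first by rewrite linear0 !normr0 mulr0.
have nx : 0 < `|x| by rewrite normr_gt0.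
have := fc (`|x|^-1 *: x); rewrite linearZ /= !normrZ ger0_norm ?invr_ge0 //.
by rewrite mulVf ?gt_eqF // lexx ler_pdivrMl // mulrC => ->.
Qed.

Lemma ball_bound_continuous {V W : normedModType R} (f : {linear V -> W})
  (c : R) : (forall x, `|x| <= 1 -> `|f x| <= c) -> continuous f.
Proof.
move=> /ball_bound_norm fc; apply/linear_bounded_continuous/linear_boundedP.
near=> r => x; apply: (le_trans (fc x)); apply: ler_wpM2r => //.
Unshelve. all: by end_near. Qed.

(** A norm bound on the values of [f] defines a convex set, so it passes from
    the extreme points to the ball. *)
Lemma ext_bound_ball {V : banachVectType R} {W : normedModType R}
    (f : {linear V -> W}) (c : R) :
  (forall x, extreme_points (@unit_ball R V) x -> `|f x| <= c) ->
  forall x, `|x| <= 1 -> `|f x| <= c.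
Proof.
move=> extf; apply: (unit_ball_sub_convex _ extf) => x y t Cx Cy /andP[t0 t1].
by rewrite /= linearD !linearZ; apply: norm_convex; rewrite // !ltW.
Qed.

Lemma polyhedral_ball_bound {V : banachVectType R} {W : normedModType R}
    (f : {linear V -> W}) :
  polyhedral V -> exists c : R, forall x, `|x| <= 1 -> `|f x| <= c.
Proof.
move=> /finite_seqP[vs extE]; exists (\sum_(v <- vs) `|f v|).
apply: ext_bound_ball => x; rewrite extE /= => xvs.
by rewrite (big_rem x xvs) /= lerDl sumr_ge0.
Qed.

Lemma polyhedral_continuous {V : banachVectType R} {W : normedModType R}
  (f : {linear V -> W}) : polyhedral V -> continuous f.
Proof. by move=> /(polyhedral_ball_bound f)[c /ball_bound_continuous]. Qed.

(** The supremum of an unbounded set of reals is 0 by convention, so the bound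
    relies on [T] being bounded, which polyhedrality provides. *)
Lemma norm_le_opnorm {V W : banachVectType R} (T : 'Hom(V, W)) :
  polyhedral V -> forall x, `|x| <= 1 -> `|T x| <= opnorm T.
Proof.
move=> /(polyhedral_ball_bound T)[c Tc] x x1; apply: sup_upper_bound; last by exists x.
by split; [exists `|T x|, x | exists c => _ [y y1 <-]; apply: Tc].
Qed.

Lemma opnorm_le {V W : banachVectType R} (T : 'Hom(V, W)) (c : R) :
  (forall x, `|x| <= 1 -> `|T x| <= c) -> opnorm T <= c.
Proof.
move=> Tc; apply: ge_sup; last by move=> _ [x x1 <-]; apply: Tc.
by exists `|T 0|, 0 => //; rewrite /unit_ball /= normr0.
Qed.

End PolyhedralBoundedness.

(** * Boundaries of half-spaces *)

Section HalfspaceBoundary.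
Set Implicit Arguments.
Unset Strict Implicit.
Context {R : realType} {V : banachVectType R}.

(** A nonzero functional takes values above [c] arbitrarily close to any point
    where it equals [c], so no such point is interior. *)
Lemma halfspace_boundary (f : 'Hom(V, R^o)) (c : R) :
  f != 0 -> continuous (f : V -> R) ->
  boundary [set x | f x <= c] = [set x | f x = c].
Proof.
move=> f0 fcont.
have -> : boundary [set x | f x <= c] = [set x | f x <= c] `\` interior [set x | f x <= c].
  rewrite /boundary; congr (_ `\` _); apply/esym/closure_id.
  by apply: (@preimage_closed _ _ (f : V -> R) [set x | x <= c]) => [x _|];
    [apply: fcont | apply: closed_le].
apply/seteqP; split=> x /=.
  move=> [fx nint]; apply/eqP; rewrite eq_le fx /= leNgt; apply/negP => lt_fx.
  apply: nint; apply: (@filterS _ _ _ [set y | f y < c]).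
    by move=> y /ltW.
  apply: open_nbhs_nbhs; split=> //.
  by apply: (@open_comp _ _ (f : V -> R) [set x | x < c]) => [y _|];
    [apply: fcont | apply: open_lt].
move=> fx; split; first by rewrite /= fx.
move=> /nbhs_ballP[e /= e0 ball_e].
have [u fu] : exists u, 0 < f u.
  apply: contrapT => nu; move/eqP: f0; apply; apply/lfunP => u.
  rewrite zero_lfunE; apply/eqP; rewrite eq_le; apply/andP; split.
    by rewrite leNgt; apply/negP => fu; apply: nu; exists u.
  rewrite leNgt; apply/negP => fu; apply: nu; exists (- u).
  by rewrite linearN oppr_gt0.
have u0 : 0 < `|u|.
  by rewrite normr_gt0; apply: contraTneq fu => ->; rewrite linear0 ltxx.
(* A step of length [e / 2] in a direction where [f] grows. *)
have /ball_e /= : ball x e (x + (e / 2 / `|u|) *: u).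
  rewrite -ball_normE /= opprD addNKr normrN normrZ ger0_norm ?divr_ge0 ?ltW //.
  by rewrite divfK ?gt_eqF //; lra.
rewrite linearD linearZ /= fx gerDl leNgt; apply/negP; rewrite negbK.
by rewrite mulr_gt0 // !divr_gt0.
Qed.

End HalfspaceBoundary.

(** * Finitely generated cones *)

Section Cones.
Set Implicit Arguments.
Unset Strict Implicit.
Context {R : realType}.

(** The sums [t_1 *: v_1 + ... + t_n *: v_n] with all coefficients in [J]: the
    cone generated by [vs] when [J] is the half-line, a compact zonotope when
    [J] is the unit interval.  The recursive form adds one generator at a
    time, which is what the elimination of coefficients needs. *)
Fixpoint coeff_hull {V : lmodType R} (J : set R) (vs : seq V) : set V :=
  if vs is v :: vs' then
    [set x | exists2 t, J t & coeff_hull J vs' (x - t *: v)]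
  else [set 0].

Definition nonneg : set R := [set t | 0 <= t].
Definition unit_interval : set R := `[0, 1]%classic.

Lemma coeff_hullS {V : lmodType R} (J K : set R) (vs : seq V) :
  J `<=` K -> coeff_hull J vs `<=` coeff_hull K vs.
Proof.
move=> JK; elim: vs => [//|v vs IHvs] x /= [t /JK Kt /IHvs xt].
by exists t.
Qed.

Lemma cone_mem0 {V : lmodType R} (vs : seq V) : coeff_hull nonneg vs 0.
Proof.
elim: vs => //= v vs IHvs; exists 0; first by rewrite /nonneg /=.
by rewrite scale0r subr0.
Qed.

Lemma cone_mem {V : lmodType R} (vs : seq V) v : v \in vs ->
  coeff_hull nonneg vs v.
Proof.
elim: vs => //= w vs IHvs; rewrite inE => /orP[/eqP ->|/IHvs vvs].
  exists 1; first by rewrite /nonneg /=.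
  by rewrite scale1r subrr; apply: cone_mem0.
by exists 0; rewrite ?scale0r ?subr0 // /nonneg /=.
Qed.

Lemma coneD {V : lmodType R} (vs : seq V) x y : coeff_hull nonneg vs x ->
  coeff_hull nonneg vs y -> coeff_hull nonneg vs (x + y).
Proof.
elim: vs x y => [|v vs IHvs] x y /=; first by move=> -> ->; rewrite addr0.
move=> [t t0 xt] [r r0 yr]; exists (t + r); first exact: addr_ge0.
by rewrite scalerDl opprD addrACA; apply: IHvs.
Qed.

Lemma coneZ {V : lmodType R} (vs : seq V) x (a : R) : 0 <= a ->
  coeff_hull nonneg vs x -> coeff_hull nonneg vs (a *: x).
Proof.
move=> a0; elim: vs x => [|v vs IHvs] x /=; first by move=> ->; rewrite scaler0.
move=> [t t0 xt]; exists (a * t); first exact: mulr_ge0.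
by rewrite -scalerA -scalerBr; apply: IHvs.
Qed.

(** The bounds [0 <= b] accommodate the sign constraint on the coefficient, as
    if [0] were one more lower bound. *)
Lemma separating_coeff (lo hi : seq R) :
  (forall a b, a \in lo -> b \in hi -> a <= b) -> (forall b, b \in hi -> 0 <= b) ->
  exists2 t : R, 0 <= t & (forall a, a \in lo -> a <= t) /\
    (forall b, b \in hi -> t <= b).
Proof.
elim: lo => [|a lo IHlo] lohi hi0; first by exists 0.
have [||t t0 [lot thi]] := IHlo; rewrite //.
  by move=> c b clo bhi; apply: lohi; rewrite // inE clo orbT.
exists (Num.max a t); first by rewrite le_max t0 orbT.
split=> [c|b bhi].
  by rewrite inE le_max => /orP[/eqP ->|/lot ->]; rewrite ?lexx ?orbT.
by rewrite ge_max thi // lohi // inE eqxx.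
Qed.

(** Fourier-Motzkin elimination.  For [x] to be in the cone of [v :: vs] there
    must be a [t >= 0] such that [g x <= t * g v] for all [g] defining the
    cone of [vs].  A [g] with [g v > 0] bounds [t] from below, one with
    [g v < 0] from above.  Such a [t] exists if and only if [0] and each lower
    bound are below each upper bound, and [g x <= 0] for the [g] with
    [g v = 0]; these conditions are again linear inequalities in [x]. *)
Lemma cone_halfspaces {V : vectType R} (vs : seq V) :
  exists gs : seq 'Hom(V, R^o), forall x,
    coeff_hull nonneg vs x <-> forall g, g \in gs -> g x <= 0.
Proof.
elim: vs => [|v vs [gs gsP]].
  (* Without generators the cone is [0], where all coordinates vanish. *)
  have [fs fsP] := exists_functional_basis V.
  exists (fs ++ [seq - f | f <- fs]) => x; split=> [/= -> g _|fx].
    by rewrite linear0.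
  apply: fsP => f ffs; apply/eqP; rewrite eq_le fx ?mem_cat ?ffs //=.
  rewrite -oppr_le0; have := fx (- f); rewrite opp_lfunE; apply.
  by rewrite mem_cat map_f ?orbT.
pose pos := [seq g : 'Hom(V, R^o) <- gs | 0 < g v].
pose neg := [seq g : 'Hom(V, R^o) <- gs | g v < 0].
exists ([seq g : 'Hom(V, R^o) <- gs | g v <= 0] ++
  [seq g v *: h - h v *: g | g : 'Hom(V, R^o) <- pos, h : 'Hom(V, R^o) <- neg]) => x; split.
  move=> [t t0 /gsP xt] k; rewrite mem_cat => /orP[|].
    rewrite mem_filter => /andP[kv /xt]; rewrite linearB linearZ /= subr_le0.
    by move=> /le_trans; apply; apply: mulr_ge0_le0.
  move=> /allpairsP[[g h] /= [+ + ->]]; rewrite !mem_filter.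
  move=> /andP[gv /xt gx] /andP[hv /xt hx].
  rewrite linearB linearZ /= in gx; rewrite linearB linearZ /= in hx.
  rewrite add_lfunE opp_lfunE !scale_lfunE; move: gx hx; rewrite /GRing.scale /=.
  by move: (g x) (h x) (g v) (h v) gv hv => gx hx gv hv *; nra.
move=> kx.
have gx0 g : g \in gs -> g v <= 0 -> g x <= 0.
  by move=> ggs gv; apply: kx; rewrite mem_cat mem_filter gv ggs.
have cross g h : g \in gs -> h \in gs -> 0 < g v -> h v < 0 -> g v * h x <= h v * g x.
  move=> ggs hgs gv hv.
  have : (g v *: h - h v *: g) x <= 0.
    apply: kx; rewrite mem_cat; apply/orP; right; apply/allpairsP.
    by exists (g, h); split=> //=; rewrite mem_filter ?gv ?hv.
  by rewrite add_lfunE opp_lfunE !scale_lfunE subr_le0.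
have [||t t0 [lot thi]] := @separating_coeff
    [seq g x / g v | g : 'Hom(V, R^o) <- pos] [seq g x / g v | g : 'Hom(V, R^o) <- neg].
- move=> _ _ /mapP[g + ->] /mapP[h + ->]; rewrite !mem_filter.
  move=> /andP[gv ggs] /andP[hv hgs].
  rewrite ler_pdivrMr // mulrAC ler_ndivlMr //.
  by have := cross g h ggs hgs gv hv; rewrite mulrC [X in _ <= X]mulrC.
- move=> _ /mapP[h + ->]; rewrite mem_filter => /andP[hv hgs].
  by rewrite mulr_le0 ?invr_le0 ?gx0 // ltW.
exists t => //; apply/gsP => g ggs; rewrite linearB linearZ /= subr_le0 /GRing.scale /=.
have [gv|gv|gv] := ltgtP (g v) 0.
- rewrite -ler_ndivlMr //; apply: thi; apply/mapP; exists g => //.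
  by rewrite mem_filter gv.
- rewrite -ler_pdivrMr //; apply: lot; apply/mapP; exists g => //.
  by rewrite mem_filter gv.
by rewrite gv mulr0 gx0 // gv.
Qed.

Lemma coeff_hull_compact {V : normedModType R} (J : set R) (vs : seq V) :
  compact J -> compact (coeff_hull J vs).
Proof.
move=> cJ; elim: vs => [|v vs IHvs] /=; first exact: compact_set1.
have -> : [set x | exists2 t, J t & coeff_hull J vs (x - t *: v)] =
    (fun p : R * V => p.1 *: v + p.2) @` (J `*` coeff_hull J vs).
  apply/seteqP; split=> x /=.
    by move=> [t Jt xt]; exists (t, x - t *: v) => //=; rewrite addrC subrK.
  by move=> [[t y] /= [Jt Cy] <-]; exists t => //; rewrite addrAC subrr add0r.
apply: continuous_compact; last exact: compact_setX.
apply: continuous_subspaceT => p.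
apply: cvgD; last exact: cvg_snd.
by apply: cvgZr_tmp; apply: cvg_fst.
Qed.

(** The inequality [`|v| <= f v] is preserved by sums and by nonnegative
    multiples. *)
Lemma cone_norm_le {V : normedModType R} (f : {linear V -> R^o}) (vs : seq V) :
  (forall v, v \in vs -> `|v| <= f v) ->
  forall x, coeff_hull nonneg vs x -> `|x| <= f x.
Proof.
elim: vs => [|v vs IHvs] vsf x /=; first by move=> ->; rewrite linear0 normr0.
move=> [t t0 xt].
have {}xt : `|x - t *: v| <= f x - t * f v.
  have <- : f (x - t *: v) = f x - t * f v by rewrite linearB linearZ.
  by apply: IHvs xt => w wvs; apply: vsf; rewrite inE wvs orbT.
have := vsf v; rewrite inE eqxx => /(_ isT) /(ler_wpM2l t0) vf.
have := ler_normD (x - t *: v) (t *: v); rewrite subrK normrZ (ger0_norm t0).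
lra.
Qed.

(** When [f] is 1 at the generators, [f x] is the sum of the coefficients of
    [x], so none of them exceeds [f x]. *)
Lemma cone_slice_unit_coeff {V : normedModType R} (f : {linear V -> R^o})
    (vs : seq V) :
  (forall v, v \in vs -> `|v| <= 1 /\ f v = 1) ->
  forall x, f x <= 1 -> coeff_hull nonneg vs x -> coeff_hull unit_interval vs x.
Proof.
elim: vs => [//|v vs IHvs] vsf x /= fx [t t0 xt].
have [_ fv] : `|v| <= 1 /\ f v = 1 by apply: vsf; rewrite inE eqxx.
have vsf' w : w \in vs -> `|w| <= 1 /\ f w = 1.
  by move=> wvs; apply: vsf; rewrite inE wvs orbT.
have fxt : f (x - t *: v) = f x - t.
  by rewrite linearB linearZ /= fv /GRing.scale /= mulr1.
have : `|x - t *: v| <= f (x - t *: v).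
  by apply: (cone_norm_le _ xt) => w /vsf'[w1 ->].
rewrite fxt => /(le_trans (normr_ge0 _)) ft.
exists t; last by apply: IHvs => //; rewrite fxt /=; rewrite /nonneg /= in t0; lra.
by rewrite /unit_interval /= in_itv /=; apply/andP; split; rewrite // (le_trans _ fx) // -subr_ge0.
Qed.

Lemma halfspaces_bigcap {V : banachVectType R} (hs : seq ('Hom(V, R^o) * R)) :
  (forall h, h \in hs -> h.1 != 0) ->
  exists (m : nat) (M : 'I_m -> set V), (forall i, closed_halfspace (M i)) /\
    [set x | forall h, h \in hs -> h.1 x <= h.2] = \bigcap_i M i.
Proof.
move=> hs0; exists (size hs).
exists (fun i => [set x | (tnth (in_tuple hs) i).1 x <= (tnth (in_tuple hs) i).2]).
split=> [i|].
  by exists (tnth (in_tuple hs) i).1, (tnth (in_tuple hs) i).2; split=> //; apply/hs0/mem_tnth.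
apply/seteqP; split=> [x hx i _ /=|x hx h /= hhs]; first by apply/hx/mem_tnth.
by have /tnthP[i ->] : h \in in_tuple hs by []; apply: hx.
Qed.

(** The half-spaces come from those of the cone and from [f x = 1] written as
    two inequalities.  Compactness comes from the bound 1 on the coefficients,
    which makes the set a closed part of a zonotope. *)
Lemma cone_slice_polyhedron {V : banachVectType R} (f : 'Hom(V, R^o))
    (vs : seq V) : (forall x, `|x| <= 1 -> `|f x| <= 1) ->
  (forall v, v \in vs -> `|v| <= 1 /\ f v = 1) -> vs != [::] ->
  polyhedron [set x | coeff_hull nonneg vs x /\ f x = 1].
Proof.
move=> fball vsf vs0.
have [gs gsP] := cone_halfspaces vs.
have [v vvs] : exists v, v \in vs.
  by case: vs vs0 {vsf gsP} => // v vs _; exists v; rewrite inE eqxx.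
have f0 : f != 0.
  by apply/eqP => fE; have [_] := vsf v vvs; rewrite fE zero_lfunE => /esym/eqP; rewrite oner_eq0.
have fcont : continuous (f : V -> R) := ball_bound_continuous fball.
(* A half-space is given by a nonzero functional, so the trivial constraints
   [0 <= 0] are filtered out. *)
pose hs := [:: (f, 1); (- f, -1)] ++ [seq (g, 0 : R) | g <- gs & g != 0].
have hsE : [set x | coeff_hull nonneg vs x /\ f x = 1] =
    [set x | forall h, h \in hs -> h.1 x <= h.2].
  apply/seteqP; split=> x /=.
    move=> [/gsP gx fx] h; rewrite /hs !inE => /or3P[/eqP ->|/eqP ->|].
    - by rewrite /= fx.
    - by rewrite /= opp_lfunE fx.
    - by move=> /mapP[g + ->] /=; rewrite mem_filter => /andP[_ /gx].
  move=> hx; split.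
    apply/gsP => g ggs; have [->|g0] := eqVneq g 0; first by rewrite zero_lfunE.
    by apply: (hx (g, 0)); rewrite /hs !inE; apply/or3P/Or33; apply: map_f; rewrite mem_filter g0.
  apply/eqP; rewrite eq_le (hx (f, 1)) ?inE ?eqxx //=.
  by have := hx (- f, -1); rewrite !inE eqxx orbT /= opp_lfunE lerN2; apply.
have [m [M [Mhs ME]]] : exists (m : nat) (M : 'I_m -> set V),
    (forall i, closed_halfspace (M i)) /\
    [set x | forall h, h \in hs -> h.1 x <= h.2] = \bigcap_i M i.
  apply: halfspaces_bigcap => h; rewrite /hs !inE => /or3P[/eqP ->|/eqP ->|] //=.
    by rewrite oppr_eq0.
  by move=> /mapP[g + ->] /=; rewrite mem_filter => /andP[].
split; last by exists m, M; rewrite hsE.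
  by exists v; split; [apply: cone_mem | have [] := vsf v vvs].
have Kc : compact (coeff_hull unit_interval vs) := coeff_hull_compact (@segment_compact _ _ _).
have -> : [set x | coeff_hull nonneg vs x /\ f x = 1] =
    coeff_hull unit_interval vs `&` [set x | f x = 1].
  apply/seteqP; split=> x /= [xvs fx]; split=> //.
    have fx1 : f x <= 1 by rewrite fx.
    exact: (cone_slice_unit_coeff vsf fx1 xvs).
  apply: coeff_hullS xvs => t; rewrite /unit_interval /= in_itv /=.
  by case/andP.
apply: compact_closedI Kc _.
apply: (@preimage_closed _ _ (f : V -> R) [set 1]) => [x _|]; first exact: fcont.
exact: closed_eq.
Qed.

End Cones.

(** * Facets of the unit ball *)

Section Facets.
Set Implicit Arguments.
Unset Strict Implicit.
Context {R : realType} {V : banachVectType R}.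

Definition unit_slice (f : 'Hom(V, R^o)) : set V :=
  [set x | `|x| <= 1 /\ f x = 1].

(** Any vector outside [W] is separated from [W] by a coordinate of its
    component complementary to [W]. *)
Lemma vanishing_functional (W : {vspace V}) :
  (forall g : 'Hom(V, R^o), (forall x, x \in W -> g x = 0) -> g = 0) ->
  W = fullv.
Proof.
move=> Wg; apply/eqP; rewrite eqEsubv subvf /=; apply/subvP => x _.
have [fs fsP] := exists_functional_basis V.
suff /eqP : x - projv W x = 0 by rewrite subr_eq0 => /eqP ->; apply: memv_proj.
apply: fsP => h _.
have hW : (h \o (\1 - projv W))%VF = 0.
  apply: Wg => w wW; rewrite comp_lfunE add_lfunE opp_lfunE id_lfunE.
  by rewrite projv_id // subrr linear0.
have := congr1 (fun k : 'Hom(V, R^o) => k x) hW.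
by rewrite /= comp_lfunE add_lfunE opp_lfunE id_lfunE zero_lfunE.
Qed.

(** Let [W] contain [F] and be proper.  The differences of points of [F] span
    a subspace [U] of [W] of dimension [dim V - 1], so [U = W] contains [F]
    itself.  If [F] is the ball, this is absurd.  If [F] lies on the boundary
    of [g <= c], then [g] vanishes on [U], so [c = 0], and a half-space
    containing the ball cannot have the origin on its boundary. *)
Lemma facet_spanning (F : set V) (W : {vspace V}) :
  polyhedral V -> unit_ball_facet F -> (forall x, F x -> x \in W) -> W = fullv.
Proof.
move=> polyV [[[[x0 Fx0] _ _] faceF] [d [U [UF minU] dimU] dV]] FW.
have UW : (U <= W)%VS.
  by apply: minU => _ [v Fv [w Fw <-]]; rewrite rpredB ?FW.
apply: contrapT => /eqP Wproper.
have ltW : (\dim W < \dim {:V})%N.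
  rewrite ltn_neqAle dimvS ?subvf // andbT; apply: contra Wproper => eqd.
  by rewrite eqEdim subvf (eqP eqd) leqnn.
have UWE : U = W by apply/eqP; rewrite eqEdim UW dimU; lia.
have x0U : x0 \in U by rewrite UWE FW.
case: faceF => [FE|[M [[g [c [g0 ME]]] ballM FE]]].
  move/eqP: Wproper; apply; apply/eqP; rewrite eqEsubv subvf /=.
  apply/subvP => x _; have [->|xn0] := eqVneq x 0; first exact: mem0v.
  have : `|x|^-1 *: x \in W.
    by apply: FW; rewrite FE /unit_ball /= normrZ normfV normr_id mulVf ?normr_eq0.
  by rewrite rpredZeq invr_eq0 normr_eq0 (negbTE xn0).
have gcont : continuous (g : V -> R) := polyhedral_continuous polyV.
have gF x : F x -> g x = c.
  by rewrite FE ME halfspace_boundary // => -[].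
have Ug : (U <= lker g)%VS.
  by apply: minU => _ [v Fv [w Fw <-]]; rewrite memv_ker linearB /= !gF // subrr.
have c0 : c = 0.
  by rewrite -(gF x0 Fx0); apply/eqP; rewrite -memv_ker (subvP Ug).
move/eqP: g0; apply; apply/lfunP => x; rewrite zero_lfunE.
have gle u : `|u| <= 1 -> g u <= 0.
  by move=> /ballM; rewrite ME c0.
have gball u : `|u| <= 1 -> `|g u| <= 0.
  move=> u1; rewrite normr_le0 eq_le gle //= -oppr_le0.
  by have := gle (- u); rewrite normrN linearN; apply.
have := ball_bound_norm gball x.
by rewrite mul0r normr_le0 => /eqP.
Qed.

(** The generators are the extreme points of the ball that lie in the slice.
    As [f <= 1] on the ball, a point of the slice can only be a proper convex
    combination of points of the slice.  Hence the points [x] of the ball for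
    which [f x = 1] implies membership in the cone form a convex set, and this
    set contains all extreme points. *)
Lemma unit_slice_cone (f : 'Hom(V, R^o)) :
  polyhedral V -> (forall x, `|x| <= 1 -> `|f x| <= 1) ->
  exists vs : seq V, (forall v, v \in vs -> `|v| <= 1 /\ f v = 1) /\
    unit_slice f = [set x | coeff_hull nonneg vs x /\ f x = 1].
Proof.
move=> /finite_seqP[es extE] fball.
pose vs := [seq v <- es | f v == 1].
have vsf v : v \in vs -> `|v| <= 1 /\ f v = 1.
  rewrite mem_filter => /andP[/eqP fv ves]; split=> //.
  by have [] : extreme_points (@unit_ball R V) v by rewrite extE.
exists vs; split=> //; apply/seteqP; split=> x /=; last first.
  move=> [xvs fx]; split=> //; rewrite -fx.
  have vs_le v : v \in vs -> `|v| <= f v by move=> /vsf[v1 ->].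
  exact: (cone_norm_le vs_le xvs).
move=> [x1 fx]; split=> //.
pose C : set V := [set x | `|x| <= 1 /\ (f x = 1 -> coeff_hull nonneg vs x)].
suff : C x by case=> _; apply.
apply: unit_ball_sub_convex => //.
- move=> y z t [y1 yC] [z1 zC] /andP[t0 t1]; split.
    by apply: norm_convex; rewrite // !ltW.
  rewrite linearD !linearZ /= /GRing.scale /= => fyz.
  have s0 : 0 < 1 - t by rewrite subr_gt0.
  have fy : f y <= 1 := le_trans (ler_norm _) (fball _ y1).
  have fz : f z <= 1 := le_trans (ler_norm _) (fball _ z1).
  apply: coneD; apply: coneZ; rewrite ?ltW //.
    by apply: yC; move: (f y) (f z) fyz fy fz => a b *; nra.
  by apply: zC; move: (f y) (f z) fyz fy fz => a b *; nra.
- move=> v extv; split; first by case: extv.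
  move=> fv; apply: cone_mem; rewrite mem_filter fv eqxx /=.
  by move: extv; rewrite extE.
Qed.

(** The separation hypothesis says that the slice spans [V].  Its differences
    lie in the kernel of [f]; together with one point of the slice, which is
    not in that kernel, they span [V], hence their dimension is
    [dim V - 1]. *)
Lemma unit_slice_facet (f : 'Hom(V, R^o)) :
  polyhedral V -> f != 0 -> (forall x, `|x| <= 1 -> `|f x| <= 1) ->
  (forall g : 'Hom(V, R^o), (forall x, unit_slice f x -> g x = 0) -> g = 0) ->
  unit_ball_facet (unit_slice f).
Proof.
move=> polyV f0 fball slice_sep.
have [x0 Fx0] : exists x0, unit_slice f x0.
  apply: contrapT => nF; move/eqP: f0; apply; apply: slice_sep => x Fx.
  by exfalso; apply: nF; exists x.
have [x01 fx0] := Fx0.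
have fcont : continuous (f : V -> R) := ball_bound_continuous fball.
split; first split.
- have [vs [vsf sliceE]] := unit_slice_cone polyV fball.
  rewrite sliceE; apply: cone_slice_polyhedron => //.
  apply/eqP => vs0; move: Fx0; rewrite sliceE vs0 /= => -[-> /esym/eqP].
  by rewrite linear0 oner_eq0.
- right; exists [set x | f x <= 1]; split; first by exists f, 1.
    by move=> x /fball; apply: le_trans; apply: ler_norm.
  by rewrite halfspace_boundary.
have [U [FU minU]] := exists_is_span [set v - w | v in unit_slice f & w in unit_slice f].
exists (\dim U); first by exists U.
have Uf : (U <= lker f)%VS.
  by apply: minU => _ [v [_ fv] [w [_ fw] <-]]; rewrite memv_ker linearB /= fv fw subrr.
have x0U : x0 \notin U.
  by apply/negP => /(subvP Uf); rewrite memv_ker fx0 oner_eq0.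
have full : (U + <[x0]>)%VS = fullv.
  apply: vanishing_functional => g gU; apply: slice_sep => x Fx.
  have -> : x = (x - x0) + x0 by rewrite subrK.
  apply/gU/memv_add; last exact: memv_line.
  by apply: FU; exists x => //; exists x0.
have x0n0 : x0 != 0 by apply: contraNneq x0U => ->; apply: mem0v.
rewrite -full dimv_disjoint_sum ?dim_vline ?x0n0 ?addn1 //.
apply/eqP; rewrite -subv0; apply/subvP => x; rewrite memv_cap memv0.
move=> /andP[xU /vlineP[k xE]]; rewrite xE in xU *.
by move: xU; rewrite rpredZeq (negbTE x0U) orbF => /eqP ->; rewrite scale0r.
Qed.

End Facets.

(** * Rank-one contractions *)

Section RankOne.
Set Implicit Arguments.
Unset Strict Implicit.
Context {R : realType} {X Y : banachVectType R}.

(** Finitely many indices, each tolerating a positive perturbation: those with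
    [a i = 1] are not perturbed at all, the others have some slack. *)
Lemma perturbation_size {I : eqType} (r : seq I) (a b : I -> R) :
  (forall i, i \in r -> a i <= 1) -> (forall i, i \in r -> 0 <= b i) ->
  (forall i, i \in r -> a i = 1 -> b i = 0) ->
  exists2 e : R, 0 < e & forall i, i \in r -> a i + e * b i <= 1.
Proof.
elim: r => [|j r IHr] a1 b0 ab; first by exists 1.
have [e e0 er] : exists2 e : R, 0 < e & forall i, i \in r -> a i + e * b i <= 1.
  by apply: IHr => i ir; [apply: a1 | apply: b0 | apply: ab]; rewrite inE ir orbT.
have jr : j \in j :: r by rewrite inE eqxx.
have [d d0 dj] : exists2 d : R, 0 < d & a j + d * b j <= 1.
  have [aj|aj] := eqVneq (a j) 1.
    by exists 1; rewrite ?ab // mulr0 addr0 aj.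
  have aj1 : 0 < 1 - a j by rewrite subr_gt0 lt_neqAle aj a1.
  have bj1 : 0 < 1 + b j by have := b0 j jr; lra.
  (* The slack divided by [1 + b j] rather than [b j], which may be 0. *)
  exists ((1 - a j) / (1 + b j)); first exact: divr_gt0.
  have : (1 - a j) / (1 + b j) * b j <= 1 - a j.
    by rewrite mulrAC ler_pdivrMr // ler_pM2l //; lra.
  lra.
have m0 : 0 < Num.min e d by rewrite lt_min e0 d0.
exists (Num.min e d) => // i; rewrite inE => /orP[/eqP ->|ir].
  by apply: le_trans dj; rewrite lerD2l ler_wpM2r ?b0 // ge_min lexx orbT.
apply: (le_trans _ (er i ir)); rewrite lerD2l ler_wpM2r ?ge_min ?lexx //.
by apply: b0; rewrite inE ir orbT.
Qed.

Lemma rank_one_normalized (T : 'Hom(X, Y)) : \dim (limg T) = 1%N ->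
  exists2 y : Y, `|y| = 1 & exists f : 'Hom(X, R^o), T = linfun (dyad f y).
Proof.
move=> /rank_one_dyad[y y0 [f ->]].
have ny : `|y| != 0 by rewrite normr_eq0.
exists (`|y|^-1 *: y); first by rewrite normrZ normfV normr_id mulVf.
exists (`|y| *: f); apply/lfunP => x; rewrite !dyadE scale_lfunE /= scalerA.
by rewrite /GRing.scale /= mulrAC divff // mul1r.
Qed.

Lemma spanning_extreme_contraction (F : set X) (T : 'Hom(X, Y)) :
  polyhedral X -> opnorm T <= 1 -> F `<=` @unit_ball R X ->
  (forall W : {vspace X}, (forall x, F x -> x \in W) -> W = fullv) ->
  (forall x, F x -> extreme_points (@unit_ball R Y) (T x)) ->
  extreme_contraction T.
Proof.
move=> polyX T1 Fball Fspan extT; split=> // A B t A1 B1 t01 TE.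
have ball C x : opnorm_ball C -> F x -> @unit_ball R Y (C x).
  by move=> C1 /Fball x1; apply: (le_trans (norm_le_opnorm C polyX x1)).
have TF x : F x -> A x = T x /\ B x = T x.
  move=> Fx; have [_ ext] := extT x Fx.
  apply: (ext _ _ t) => //; [exact: ball | exact: ball |].
  by rewrite [in LHS]TE add_lfunE !scale_lfunE.
have agree (C : 'Hom(X, Y)) : (forall x, F x -> C x = T x) -> C = T.
  move=> CT; have kfull : lker (C - T) = fullv.
    by apply: Fspan => x Fx; rewrite memv_ker add_lfunE opp_lfunE CT // subrr.
  apply/eqP; rewrite -subr_eq0; apply/eqP/lfunP => x.
  by rewrite zero_lfunE; apply/eqP; rewrite -memv_ker kfull memvf.
by split; apply: agree => x /TF[].
Qed.

(** If [g] vanishes on the slice, it vanishes at every extreme point [v] with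
    [`|f v| = 1], as [v] or [- v] is in the slice.  At the other extreme
    points [`|f v|] is smaller than 1, so for small [e] the maps given by
    [f + e *: g] and [f - e *: g] are contractions with midpoint [T]; both
    equal [T] and [g = 0]. *)
Lemma dyad_extreme_separating (f : 'Hom(X, R^o)) (y : Y) :
  polyhedral X -> `|y| = 1 -> (forall x, `|x| <= 1 -> `|f x| <= 1) ->
  extreme_contraction (linfun (dyad f y)) ->
  forall g : 'Hom(X, R^o), (forall x, unit_slice f x -> g x = 0) -> g = 0.
Proof.
move=> /finite_seqP[es extE] y1 fball [_ extT] g gF.
have es1 v : v \in es -> `|v| <= 1.
  by move=> ves; have [] : extreme_points (@unit_ball R X) v by rewrite extE.
have [e e0 eP] : exists2 e : R, 0 < e & forall v, v \in es -> `|f v| + e * `|g v| <= 1.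
  apply: perturbation_size => v ves; [exact/fball/es1 | exact: normr_ge0 |].
  have [fv0|fv0] := ger0P (f v) => fv; apply/normr0P/eqP.
    by apply: gF; split=> //; apply: es1.
  apply/oppr_inj; rewrite oppr0 -linearN; apply: gF; split.
    by rewrite normrN es1.
  by rewrite linearN.
pose P (s : R) : 'Hom(X, Y) := linfun (dyad (f + s *: g) y).
have PE (s : R) x : P s x = (f x + s * g x) *: y.
  by rewrite /P dyadE add_lfunE scale_lfunE.
have P1 s : `|s| <= e -> opnorm_ball (P s).
  move=> se; apply: opnorm_le; apply: ext_bound_ball => v; rewrite extE /= => ves.
  rewrite PE normrZ y1 mulr1; apply: (le_trans (ler_normD _ _)).
  by apply: (le_trans _ (eP v ves)); rewrite lerD2l normrM ler_wpM2r.
have [] : P e = linfun (dyad f y) /\ P (- e) = linfun (dyad f y).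
  apply: (extT _ _ 2^-1); [apply: P1 | apply: P1 | lra |].
  - by rewrite gtr0_norm.
  - by rewrite normrN gtr0_norm.
  - apply/lfunP => x; rewrite dyadE add_lfunE !scale_lfunE !PE !scalerA -scalerDl.
    by congr (_ *: _); field.
move=> PT _; apply/lfunP => x; rewrite zero_lfunE.
have := congr1 (fun A : 'Hom(X, Y) => A x) PT; rewrite /= PE dyadE => /eqP.
rewrite -subr_eq0 -scalerBl addrAC subrr add0r scaler_eq0 mulf_eq0 (gt_eqF e0) /=.
by rewrite -[y == 0]normr_eq0 y1 oner_eq0 orbF => /eqP.
Qed.

(** Replacing [y] by a vector of the unit ball of [Y] keeps a contraction, and
    the vector is recovered as the value at [x0]. *)
Lemma dyad_extreme_vector (f : 'Hom(X, R^o)) (y : Y) (x0 : X) :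
  `|y| = 1 -> (forall x, `|x| <= 1 -> `|f x| <= 1) -> f x0 = 1 ->
  extreme_contraction (linfun (dyad f y)) -> extreme_points (@unit_ball R Y) y.
Proof.
move=> y1 fball fx0 [_ extT]; split=> [|a b t a1 b1 t01 yE].
  by rewrite /unit_ball /= y1.
have ball c : `|c| <= 1 -> opnorm_ball (linfun (dyad f c)).
  move=> c1; apply: opnorm_le => x x1.
  by rewrite dyadE normrZ mulr_ile1 // fball.
have [Ta Tb] : linfun (dyad f a) = linfun (dyad f y) /\
    linfun (dyad f b) = linfun (dyad f y).
  apply: (extT _ _ t); [exact: ball | exact: ball | by [] |].
  apply/lfunP => x; rewrite add_lfunE !scale_lfunE !dyadE yE scalerDr !scalerA.
  by rewrite ![f x * _]mulrC.
have at_x0 c : linfun (dyad f c) = linfun (dyad f y) -> c = y.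
  by move=> /(congr1 (fun A : 'Hom(X, Y) => A x0)); rewrite /= !dyadE fx0 !scale1r.
by split; apply: at_x0.
Qed.

Lemma dyad_norm_attainment (f : 'Hom(X, R^o)) (y : Y) :
  `|y| = 1 -> (forall x, `|x| <= 1 -> `|f x| <= 1) ->
  opnorm (linfun (dyad f y)) = 1 ->
  norm_attainment (linfun (dyad f y)) =
    unit_slice f `|` [set - x | x in unit_slice f].
Proof.
move=> y1 fball T1; rewrite /norm_attainment T1; apply/seteqP; split=> x /=.
  rewrite /unit_sphere /= dyadE normrZ y1 mulr1 => -[x1 fx].
  have [fx0|fx0] := ger0P (f x).
    by left; split; [rewrite x1 | rewrite -fx ger0_norm].
  right; exists (- x); last by rewrite opprK.
  by split; [rewrite normrN x1 | rewrite linearN -fx ltr0_norm].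
have slice_sphere u : unit_slice f u -> `|u| = 1.
  move=> [u1 fu]; apply/eqP; rewrite eq_le u1 /=.
  have : `|f u| <= 1 * `|u| := ball_bound_norm fball u.
  by rewrite fu normr1 mul1r.
rewrite /unit_sphere /= dyadE normrZ y1 mulr1.
case=> [Fx|[u Fu <-]].
  by rewrite slice_sphere //; have [_ ->] := Fx; rewrite normr1.
have fNu : f (- u) = - 1 by have [_ <-] := Fu; rewrite linearN.
by rewrite normrN slice_sphere // fNu normrN1.
Qed.

End RankOne.

Theorem theorem2p3 (R : realType) (X Y : banachVectType R) (n : nat)
    (polyX : polyhedral X) (polyY : polyhedral Y) (dimX : \dim {:X} = n)
    (T : 'Hom(X, Y)) (normT : opnorm T = 1) (rankT : \dim (limg T) = 1%N) :
  extreme_contraction T <->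
  exists F : set X,
    [/\ unit_ball_facet F,
        norm_attainment T = F `|` [set - x | x in F] &
        forall x, F x -> extreme_points (@unit_ball R Y) (T x)].
Proof.
split; last first.
  move=> [F [facetF MT extF]].
  apply: (@spanning_extreme_contraction R X Y F) => //.
  - by rewrite normT.
  - move=> x Fx; have [x1 _] : norm_attainment T x by rewrite MT; left.
    by rewrite /unit_ball /= x1.
  - by move=> W; apply: facet_spanning.
have [y y1 [f TE]] := rank_one_normalized rankT; subst T => extT.
have fball x : `|x| <= 1 -> `|f x| <= 1.
  move=> /(norm_le_opnorm (linfun (dyad f y)) polyX).
  by rewrite normT dyadE normrZ y1 mulr1.
have f0 : f != 0.
  apply/eqP => f0; move: rankT; rewrite f0 => /eqP.
  have -> : linfun (dyad (0 : 'Hom(X, R^o)) y) = 0.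
    by apply/lfunP => x; rewrite dyadE !zero_lfunE scale0r.
  by rewrite lim0g dimv0.
exists (unit_slice f); split.
- exact: unit_slice_facet (dyad_extreme_separating polyX y1 fball extT).
- exact: dyad_norm_attainment.
- by move=> x [_ fx]; rewrite dyadE fx scale1r; apply: (dyad_extreme_vector y1 fball fx).
Qed.
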